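(* Let $f\in T$ be such that either $f$ preserves dyadic parity (for every dyadic rational $t\in[0,1)$, $f(t)$ and $t$ have the same dyadic parity), or $f$ switches dyadic parity (for every dyadic rational $t\in[0,1)$, $f(t)$ and $t$ have opposite dyadic parities). Then $f\in\vec T$.
   Context: **Dyadic parity.** A dyadic rational $t\in[0,1)$ has a finite binary expansion; its dyadic parity is the parity (even or odd) of the sum of its binary digits. The circle is identified with $[0,1)$. **Trees and $T$.** A full binary tree is a finite rooted plane tree in which every vertex has either $0$ children or $2$ children (a left and a right one); leaves are numbered $1,2,\dots$ from left to right. Associate $[0,1)$ with the root, and if $[a,b)$ is associated with a vertex, associate $[a,\frac{a+b}2)$ with its left child and $[\frac{a+b}2,b)$ with its right child. Given full binary trees $R,S$ with the same number $m$ of leaves and $1\le n\le m$, the triple $(R,S,n)$ represents the homeomorphism of the circle $[0,1]/(0\sim 1)$ which, for each $i$, maps the interval of leaf $i$ of $R$ affinely and increasingly onto the interval of leaf $i+n-1$ (taken mod $m$ in $\{1,\dots,m\}$) of $S$; leaf $i$ of $R$ is said to be identified with leaf $i+n-1$ of $S$. Thompson's group $T$ is the group of all homeomorphisms so represented. A triple is reduced if there is no caret in $R$ both of whose children are leaves that are identified (left with left, right with right) with the two leaf children of a caret of $S$; every element of $T$ has a unique reduced triple. **Thompson graphs.** For a full binary tree with leaves $l_1,\dots,l_m$ arranged on a horizontal line, its Thompson graph has vertices $v_1,\dots,v_m$ on that line, $v_1$ to the left of $l_1$ and $v_i$ between $l_{i-1}$ and $l_i$; for each left edge $e$ of the tree,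 the unique pair $v_i,v_j$ that can be joined by a path above the line crossing the tree only at $e$ is joined by an edge. (Equivalently: for each non-leaf vertex $p$, join $v_i$ to $v_j$ where $l_i$ is the leftmost leaf below the left child of $p$ and $l_j$ is the leftmost leaf below the right child of $p$.) The Thompson graph of $f\in T$ with reduced triple $(R,S,n)$ is obtained from the Thompson graphs of $R$ and $S$ by identifying their vertices in the same way as the leaves (the $i$th vertex for $R$ with the $(i+n-1)$st, mod $m$, for $S$). $\vec T$ is the subgroup of all $f\in T$ whose Thompson graph is bipartite. *)

(* Defs.v *)
From HB Require Import structures.
From mathcomp Require Import all_boot all_order all_algebra.
From mathcomp Require Import classical_sets reals.

Set Implicit Arguments.
Unset Strict Implicit.
Unset Printing Implicit Defensive.

Import Order.TTheory GRing.Theory Num.Theory.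

(* The circle [0,1]/(0 ~ 1), identified with [0,1). *)
Definition circle (R : realType) : Type := {x : R | (0 <= x < 1)%R}.

(* The number with finite binary expansion 0.s_0 s_1 ... s_(k-1), where
   k = size s; the expansion of a dyadic rational of [0,1) is unique up to
   trailing zeros, so [dyadic_parity] below is a partial function of t,
   defined exactly on the dyadic rationals of [0,1). *)
Definition binary_value (R : realType) (s : seq bool) : R :=
  (\sum_(i < size s) (nth false s i)%:R / 2 ^+ i.+1)%R.

(* b = true means odd, b = false means even. *)
Definition dyadic_parity (R : realType) (t : R) (b : bool) : Prop :=
  exists s : seq bool,
    t = binary_value R s /\ odd (\sum_(i < size s) nth false s i) = b.

Definition preserves_dyadic_parity (R : realType)
    (f : circle R -> circle R) : Prop :=
  forall (t : circle R) (b : bool),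
    dyadic_parity (sval t) b -> dyadic_parity (sval (f t)) b.

Definition switches_dyadic_parity (R : realType)
    (f : circle R -> circle R) : Prop :=
  forall (t : circle R) (b : bool),
    dyadic_parity (sval t) b -> dyadic_parity (sval (f t)) (~~ b).

Inductive btree : Type :=
| Leaf
| Node of btree & btree.

Fixpoint nleaves (t : btree) : nat :=
  if t is Node l r then nleaves l + nleaves r else 1.

(* Leaves are numbered from 0, left to right. *)
Fixpoint leaf_intervals (R : realType) (t : btree) (a b : R) : seq (R * R) :=
  if t is Node l r then
    leaf_intervals l a ((a + b) / 2)%R ++ leaf_intervals r ((a + b) / 2)%R b
  else [:: (a, b)].

Definition leaf_interval (R : realType) (t : btree) (i : nat) : R * R :=
  nth (0, 0)%R (leaf_intervals t 0%R 1%R) i.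

Record triple : Type := Triple {
  dom_tree : btree;
  cod_tree : btree;
  shift : nat;
  same_nleaves : nleaves dom_tree = nleaves cod_tree;
  shift_range : 1 <= shift <= nleaves dom_tree
}.

(* With leaves numbered from 1, leaf i is identified with leaf i + n - 1 taken
   mod m in {1, ..., m}; numbered from 0 this is i + (n - 1) mod m. *)
Definition ident (p : triple) (i : nat) : nat :=
  (i + (shift p - 1)) %% nleaves (dom_tree p).

Definition represents (R : realType) (p : triple)
    (f : circle R -> circle R) : Prop :=
  forall i : nat, i < nleaves (dom_tree p) ->
    let: (a, b) := leaf_interval R (dom_tree p) i in
    let: (c, d) := leaf_interval R (cod_tree p) (ident p i) in
    forall x : circle R, (a <= sval x < b)%R ->
      (sval (f x) = c + (d - c) / (b - a) * (sval x - a))%R.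

(* A represented map is automatically a homeomorphism of the circle. *)
Definition thompson_T (R : realType) : set (circle R -> circle R) :=
  [set f | exists p : triple, represents p f]%classic.

(* The indices of the left leaves of the carets of t whose two children are
   leaves, when the leaves of t are numbered from k on. *)
Fixpoint leaf_carets (t : btree) (k : nat) : seq nat :=
  match t with
  | Leaf => [::]
  | Node Leaf Leaf => [:: k]
  | Node l r => leaf_carets l k ++ leaf_carets r (k + nleaves l)
  end.

Definition reduced (p : triple) : Prop :=
  ~ exists i j : nat,
      [/\ i \in leaf_carets (dom_tree p) 0, j \in leaf_carets (cod_tree p) 0,
          ident p i = j & ident p i.+1 = j.+1].

(* Vertices are numbered like leaves, here from k on.  The left edge under an
   inner vertex joins the leftmost leaves below its two children. *)
Fixpoint tree_edges (t : btree) (k : nat) : seq (nat * nat) :=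
  if t is Node l r then
    (k, k + nleaves l) :: tree_edges l k ++ tree_edges r (k + nleaves l)
  else [::].

Definition tree_graph (t : btree) : rel nat :=
  fun i j => ((i, j) \in tree_edges t 0) || ((j, i) \in tree_edges t 0).

(* The vertices are those of the domain tree; the edges of the graph of the
   codomain tree are pulled back along the identification.  Parallel edges are
   merged, which does not affect bipartiteness. *)
Definition thompson_graph (p : triple) : rel 'I_(nleaves (dom_tree p)) :=
  fun i j => tree_graph (dom_tree p) i j
          || tree_graph (cod_tree p) (ident p i) (ident p j).

Definition bipartite (V : finType) (e : rel V) : Prop :=
  exists c : V -> bool, forall x y : V, e x y -> c x != c y.

(* The reduced triple of an element of T exists and is unique. *)
Definition vec_T (R : realType) : set (circle R -> circle R) :=
  [set f | thompson_T f /\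
     exists p : triple,
       [/\ represents p f, reduced p & bipartite (@thompson_graph p)]]%classic.

(* Main.v *)
(* Colour the i-th vertex by the dyadic parity of the left endpoint of leaf i.
   The edge under an inner vertex with address w joins the leaves with
   addresses w0...0 and w10...0, whose left endpoints have opposite parities,
   so this 2-colours the graph of any tree.  Since f sends left endpoints of
   leaves of R to those of the identified leaves of S, the colourings of the two
   trees agree, or are opposite, at every vertex.  This holds for any triple
   representing f, and collapsing identified carets yields a reduced one. *)
Require Import Defs.
From HB Require Import structures.
From mathcomp Require Import all_boot all_order all_algebra.
From mathcomp Require Import classical_sets reals.
From mathcomp Require Import boolp zify ring lra.

Set Implicit Arguments.
Unset Strict Implicit.
Unset Printing Implicit Defensive.

Import Order.TTheory GRing.Theory Num.Theory.

(** * Digit sums and values of finite binary expansions *)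

Definition digit_parity (s : seq bool) : bool :=
  odd (\sum_(i < size s) nth false s i).

Lemma digit_parity_cons b s : digit_parity (b :: s) = b (+) digit_parity s.
Proof. by rewrite /digit_parity big_ord_recl oddD oddb. Qed.

Lemma digit_parity_rcons s b : digit_parity (rcons s b) = digit_parity s (+) b.
Proof.
elim: s => [|c s IHs] /=; last by rewrite !digit_parity_cons IHs addbA.
by rewrite digit_parity_cons /digit_parity big_ord0 addbF.
Qed.

Section BinaryValue.
Variable R : realType.
Local Open Scope ring_scope.

Lemma binary_value_nil : binary_value R [::] = 0.
Proof. by rewrite /binary_value big_ord0. Qed.

Lemma binary_value_cons b s :
  binary_value R (b :: s) = (b%:R + binary_value R s) / 2.
Proof.
rewrite /binary_value big_ord_recl /= expr1 mulrDl mulr_suml; congr (_ + _).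
by apply: eq_bigr => i _; rewrite -mulrA -invfM -exprSr.
Qed.

Lemma binary_value_rcons s b :
  binary_value R (rcons s b) = binary_value R s + b%:R / 2 ^+ (size s).+1.
Proof.
elim: s => [|c s IHs] /=; rewrite binary_value_cons ?binary_value_nil.
  by rewrite expr1 addr0 add0r.
rewrite IHs binary_value_cons [2 ^+ (size s).+2]exprSr invfM.
by rewrite !mulrDl addrA mulrA.
Qed.

Lemma binary_value_bounds s : 0 <= binary_value R s < 1.
Proof.
elim: s => [|b s IHs]; first by rewrite binary_value_nil lexx ltr01.
rewrite binary_value_cons; move: IHs; case: b => /= /andP[? ?];
  apply/andP; split; lra.
Qed.

Lemma binary_value_eq0 s : binary_value R s = 0 -> digit_parity s = false.
Proof.
elim: s => [|b s IHs]; first by rewrite /digit_parity big_ord0.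
rewrite binary_value_cons digit_parity_cons.
have /andP[? ?] := binary_value_bounds s.
by case: b => /= s0; [exfalso; lra | apply: IHs; lra].
Qed.

(** Tails have value in [0,1), so the leading digit tells whether the value is at least 1/2 and can
    be compared and removed. Once one expansion is exhausted, the other has value 0, hence an even
    digit sum. *)
Lemma eq_digit_parity s s' :
  binary_value R s = binary_value R s' -> digit_parity s = digit_parity s'.
Proof.
elim: s s' => [|b s IHs] [|b' s'] //.
- by rewrite binary_value_nil => /esym/binary_value_eq0->;
    rewrite /digit_parity big_ord0.
- by rewrite binary_value_nil => /binary_value_eq0->;
    rewrite /digit_parity big_ord0.
rewrite !binary_value_cons !digit_parity_cons.
have /andP[? ?] := binary_value_bounds s.
have /andP[? ?] := binary_value_bounds s'.
by case: b; case: b' => /= ss'; try (exfalso; lra);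
  rewrite (IHs s') //; lra.
Qed.

Lemma dyadic_parity_uniq (t : R) b b' :
  dyadic_parity t b -> dyadic_parity t b' -> b = b'.
Proof. by move=> [s [-> <-]] [s' [+ <-]]; apply: eq_digit_parity. Qed.

End BinaryValue.

(** * The parity colouring of a tree *)

Lemma nleaves_gt0 t : 0 < nleaves t.
Proof. by elim: t => //= l IHl r _; rewrite addn_gt0 IHl. Qed.

(** Parities of the left endpoints of the leaves, where [b] is that of the root: a left child keeps
    the left endpoint, a right child adds a digit 1. *)
Fixpoint leaf_parities (t : btree) (b : bool) : seq bool :=
  if t is Node l r then leaf_parities l b ++ leaf_parities r (~~ b)
  else [:: b].

Lemma size_leaf_parities t b : size (leaf_parities t b) = nleaves t.
Proof. by elim: t b => //= l IHl r IHr b; rewrite size_cat IHl IHr. Qed.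

Lemma leaf_parities_head t b : nth false (leaf_parities t b) 0 = b.
Proof.
elim: t b => //= l IHl r _ b.
by rewrite nth_cat size_leaf_parities nleaves_gt0 IHl.
Qed.

(** The bounds serve the induction: they place both ends of an edge of a subtree in that subtree's
    half of the concatenated colours. *)
Lemma tree_edges_parity t k b i j : (i, j) \in tree_edges t k ->
  [/\ k <= i < k + nleaves t, k <= j < k + nleaves t &
      nth false (leaf_parities t b) (i - k)
        != nth false (leaf_parities t b) (j - k)].
Proof.
elim: t k b => //= l IHl r IHr k b.
have [l0 r0] := (nleaves_gt0 l, nleaves_gt0 r).
rewrite inE mem_cat !nth_cat size_leaf_parities.
case/or3P=> [/eqP[-> ->]|/(IHl _ b)[? ? lij]|/(IHr _ (~~ b))[? ? rij]].
- split; [lia | lia |].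
  have -> : k - k < nleaves l by lia.
  have -> : (k + nleaves l - k < nleaves l) = false by lia.
  by rewrite addKn !subnn !leaf_parities_head; case: (b).
- split; [lia | lia |].
  have -> : i - k < nleaves l by lia.
  by have -> : j - k < nleaves l by lia.
- split; [lia | lia |].
  have -> : (i - k < nleaves l) = false by lia.
  have -> : (j - k < nleaves l) = false by lia.
  by rewrite -!subnDA.
Qed.

Lemma tree_graph_parity t b i j : tree_graph t i j ->
  nth false (leaf_parities t b) i != nth false (leaf_parities t b) j.
Proof.
by case/orP=> /(tree_edges_parity b)[_ _]; rewrite !subn0 // eq_sym.
Qed.

Lemma ident_lt p i : ident p i < nleaves (cod_tree p).
Proof. by rewrite -same_nleaves ltn_mod nleaves_gt0. Qed.

(** * Leaf intervals and their left endpoints *)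

Section LeafIntervals.
Variable R : realType.
Local Open Scope ring_scope.

Lemma size_leaf_intervals t (a b : R) :
  size (leaf_intervals t a b) = nleaves t.
Proof. by elim: t a b => //= l IHl r IHr a b; rewrite size_cat IHl IHr. Qed.

Lemma leaf_intervals_bounds t (a b : R) i : a < b -> (i < nleaves t)%N ->
  let: (c, d) := nth (0, 0) (leaf_intervals t a b) i in
  [/\ a <= c, c < d & d <= b].
Proof.
elim: t a b i => [|l IHl r IHr] a b i ab /=.
  by case: i => //= _; rewrite !lexx ab.
move=> ilr; rewrite nth_cat size_leaf_intervals; case: ltnP => il.
  have mid : a < (a + b) / 2 by lra.
  by have := IHl _ _ _ mid il; case: nth => c d [? ? ?]; split; lra.
have mid : (a + b) / 2 < b by lra.
have ir : (i - nleaves l < nleaves r)%N by lia.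
by have := IHr _ _ _ mid ir; case: nth => c d [? ? ?]; split; lra.
Qed.

(** The vertex with address [w] has the interval of length 2^-|w| starting at 0.w; leaving [w]
    arbitrary lets the induction pass to w0 and w1. *)
Lemma leaf_intervals_parity t w i : (i < nleaves t)%N ->
  let a := binary_value R w in
  dyadic_parity (nth (0, 0) (leaf_intervals t a (a + 2 ^- size w)) i).1
    (nth false (leaf_parities t (digit_parity w)) i).
Proof.
elim: t w i => [|l IHl r IHr] w i /=; first by case: i => //= _; exists w.
move=> ilr; rewrite !nth_cat size_leaf_intervals size_leaf_parities.
have V2 : 2 ^- (size w).+1 = 2 ^- size w / 2 :> R by rewrite exprSr invfM.
set a := binary_value R w.
have midE : (a + (a + 2 ^- size w)) / 2 = a + 2 ^- (size w).+1.
  by rewrite V2; lra.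
have endE : a + 2 ^- size w = a + 2 ^- (size w).+1 + 2 ^- (size w).+1.
  by rewrite V2; lra.
rewrite midE; case: ltnP => il.
  have := IHl (rcons w false) i il.
  by rewrite digit_parity_rcons binary_value_rcons size_rcons mul0r addr0 addbF.
have ir : (i - nleaves l < nleaves r)%N by lia.
have := IHr (rcons w true) _ ir.
by rewrite digit_parity_rcons binary_value_rcons size_rcons mul1r addbT endE.
Qed.

Lemma leaf_interval_parity t i : (i < nleaves t)%N ->
  dyadic_parity (leaf_interval R t i).1 (nth false (leaf_parities t false) i).
Proof.
move=> /(leaf_intervals_parity [::])/=.
by rewrite binary_value_nil expr0 invr1 add0r /digit_parity big_ord0.
Qed.

Lemma represents_left_endpoint p (f : circle R -> circle R) i :
  represents p f -> (i < nleaves (dom_tree p))%N ->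
  exists2 x : circle R, sval x = (leaf_interval R (dom_tree p) i).1 &
    sval (f x) = (leaf_interval R (cod_tree p) (ident p i)).1.
Proof.
move=> pf im; have := leaf_intervals_bounds (@ltr01 R) im.
have := pf i im; rewrite -/(leaf_interval R _ i).
case: leaf_interval => a b; case: leaf_interval => c d fE [a0 ab b1].
have a01 : 0 <= a < 1 by rewrite a0 (lt_le_trans ab).
exists (exist _ a a01) => //=.
by rewrite fE /= ?lexx ?ab // subrr mulr0 addr0.
Qed.

(** * Collapsing a caret of a tree *)

(** Replacing the caret by a leaf merges the two halves of [(u, v)] and leaves the intervals [X]
    before and [Y] after it alone. *)
Lemma collapse_caret t k i : i \in leaf_carets t k ->
  exists t', [/\ nleaves t = (nleaves t').+1, (k <= i < k + nleaves t')%N &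
    forall a b : R, exists X u v Y, [/\ size X = (i - k)%N,
      leaf_intervals t a b = X ++ [:: (u, (u + v) / 2), ((u + v) / 2, v) & Y] &
      leaf_intervals t' a b = X ++ (u, v) :: Y]].
Proof.
elim: t k => //= l IHl r IHr k ilr.
(* Separates the caret with two leaf children from the recursive branch of [leaf_carets]. *)
have [[-> [-> ->]]|{}ilr] : i = k /\ (l = Leaf /\ r = Leaf) \/
    i \in leaf_carets l k ++ leaf_carets r (k + nleaves l).
  case: l r ilr {IHl IHr} => [|? ?] [|? ?] //=; try by right.
  by rewrite inE => /eqP; left.
- exists Leaf; split=> //= [|a b]; first by lia.
  by exists [::], a, b, [::]; rewrite subnn.
have [l0 r0] := (nleaves_gt0 l, nleaves_gt0 r).
move: ilr; rewrite mem_cat => /orP[/IHl|/IHr] [t' [nt' it' tX]].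
- exists (Node t' r); split=> /= [||a b]; try lia.
  have [X [u [v [Y [sX -> ->]]]]] := tX a ((a + b) / 2).
  by exists X, u, v, (Y ++ leaf_intervals r ((a + b) / 2) b); rewrite -!catA.
- exists (Node l t'); split=> /= [||a b]; try lia.
  have [X [u [v [Y [sX -> ->]]]]] := tX ((a + b) / 2) b.
  exists (leaf_intervals l a ((a + b) / 2) ++ X), u, v, Y.
  by rewrite size_cat size_leaf_intervals sX !catA; split=> //; lia.
Qed.

(** [k + (i < k)] is the number that leaf [k] of the collapsed tree had before: only leaves after
    the caret move down by one. *)
Lemma collapse_leaf_interval t i : i \in leaf_carets t 0 ->
  exists t', [/\ nleaves t = (nleaves t').+1, (i < nleaves t')%N,
    forall k, k != i ->
      leaf_interval R t' k = leaf_interval R t (k + (i < k))%N &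
    let: (u, v) := leaf_interval R t' i in
    leaf_interval R t i = (u, (u + v) / 2) /\
    leaf_interval R t i.+1 = ((u + v) / 2, v)].
Proof.
move=> /collapse_caret[t' [nt' it' tX]]; exists t'.
have [X [u [v [Y [sX]]]]] := tX 0 1.
rewrite subn0 in sX; rewrite /leaf_interval => -> ->; split=> // [k kNi|].
  rewrite !nth_cat sX; case: (ltngtP k i) kNi => // ki _.
    by rewrite addn0 ki.
  have -> : (k + 1 < i)%N = false by lia.
  have -> : (k + 1 - i = (k - i.+1).+2)%N by lia.
  by have -> : (k - i = (k - i.+1).+1)%N by lia.
rewrite !nth_cat sX ltnn subnn /=.
have -> : (i.+1 < i)%N = false by lia.
by rewrite subSnn.
Qed.

End LeafIntervals.

(** * Reduction of triples *)

Lemma modn_lt_double n x : x < n + n -> x %% n = if x < n then x else x - n.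
Proof.
move=> xn; case: ltnP => nx; first exact: modn_small.
by rewrite -{1}(subnK nx) modnDr modn_small //; lia.
Qed.

(** Merging i with i+1 and j with j+1 turns a rotation mod m+1 into one mod m, since consecutive
    indices go to consecutive ones. *)
Lemma collapse_shift m s i (j := (i + s) %% m.+1) : i < m -> s <= m ->
  (i.+1 + s) %% m.+1 = j.+1 ->
  exists s', [/\ s' < m, (i + s') %% m = j & forall k, k < m -> k != i ->
    (k + s') %% m != j /\
    (k + (i < k) + s) %% m.+1 = (k + s') %% m + (j < (k + s') %% m)].
Proof.
rewrite /j => im sm; rewrite !modn_lt_double; try lia.
(* Without wrap-around i + s = j; otherwise i + s = j + m + 1, and lowering s by one gives j + m. *)
move=> ij; exists (if i + s < m.+1 then s else s.-1).
have s'm : (if i + s < m.+1 then s else s.-1) < m by case: ifP ij; case: ifP; lia.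
split=> // [|k km ki].
  by rewrite modn_lt_double; [case: ifP ij; case: ifP; case: ifP; lia|lia].
rewrite !modn_lt_double; try (case: ltnP; lia).
by move: s'm ij; case: (ltnP i k) => ik; repeat case: ifP; lia.
Qed.

Lemma collapse_represents (R : realType) p (f : circle R -> circle R) :
  represents p f -> ~ reduced p ->
  exists2 p', represents p' f & nleaves (dom_tree p') < nleaves (dom_tree p).
Proof.
move=> pf /contrapT[i [j [idom jcod ij ij1]]].
have [t' [nt' it' tE]] := collapse_leaf_interval R idom.
have [u' [nu' ju' uE]] := collapse_leaf_interval R jcod.
have eq_n : nleaves t' = nleaves u'.
  by apply: succn_inj; rewrite -nt' -nu' same_nleaves.
move=> uj ti; have sp := shift_range p.
have pred_shift : shift p - 1 <= nleaves t' by lia.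
move: ij ij1; rewrite /ident nt' => ij ij1; rewrite -ij in ij1.
have [s' [s't' is' ks']] := collapse_shift it' pred_shift ij1.
have s'_range : 1 <= s'.+1 <= nleaves t' by [].
exists (Triple eq_n s'_range); last exact: ltnSn.
move=> k /= kt'; rewrite /ident /= subn1 /=.
have [->|ki] := eqVneq k i.
  (* On the merged leaf both halves carry the same affine map from [a,b) to [c,d). *)
  have := pf i; have := pf i.+1; rewrite /ident nt' ij1 is' ij.
  move: uj ti; case: (leaf_interval R t' i) => a b.
  case: (leaf_interval R u' j) => c d [-> ->] [-> ->].
  move=> /(_ it') fr /(_ (ltnW it')) fl x /andP[ax xb].
  have ba0 : (b - a != 0)%R by rewrite subr_eq0 gt_eqF // (le_lt_trans ax xb).
  have [xm|mx] := ltP (sval x) ((a + b) / 2)%R.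
    by rewrite fl ?ax //; field.
  by rewrite fr ?mx //; field.
have [ks'j ksE] := ks' k kt' ki; rewrite ij in ks'j ksE.
rewrite tE // uE // -ksE -nt'.
by apply: pf; rewrite nt'; case: (ltnP i k); lia.
Qed.

(** Each collapse lowers the number of leaves, so collapsing terminates. *)
Lemma exists_reduced (R : realType) (f : circle R -> circle R) :
  thompson_T f -> exists2 p, represents p f & reduced p.
Proof.
case=> p; have [n] := ubnP (nleaves (dom_tree p)).
elim: n p => // n IHn p pn pf.
have [rp|nrp] := pselect (reduced p); first by exists p.
have [p' p'f p'p] := collapse_represents pf nrp.
exact: IHn p' (leq_trans p'p pn) p'f.
Qed.

(** * Bipartiteness of the Thompson graph *)

(** The bit [e] treats preserving ([false]) and switching ([true]) at once. *)
Lemma parity_bipartite (R : realType) p (f : circle R -> circle R) e :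
  represents p f ->
  (forall t b, dyadic_parity (sval t) b ->
    dyadic_parity (sval (f t)) (e (+) b)) ->
  bipartite (@thompson_graph p).
Proof.
move=> pf fe; pose c t i := nth false (leaf_parities t false) i.
have cE i : i < nleaves (dom_tree p) ->
    c (cod_tree p) (ident p i) = e (+) c (dom_tree p) i.
  move=> im; have [x xE fxE] := represents_left_endpoint pf im.
  apply: (@dyadic_parity_uniq R (sval (f x))).
    by rewrite fxE; apply: leaf_interval_parity; apply: ident_lt.
  by apply: fe; rewrite xE; apply: leaf_interval_parity.
exists (fun i : 'I__ => c (dom_tree p) i) => i j.
case/orP=> /(tree_graph_parity false) //.
(* For an edge of the codomain tree, both colours differ from those of the domain tree by the same
   [e], which cancels. *)
by rewrite -!/(c _ _) !cE // (inj_eq (@addbI e)).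
Qed.

Theorem theorem3 (R : realType) (f : circle R -> circle R) :
  thompson_T f ->
  preserves_dyadic_parity f \/ switches_dyadic_parity f ->
  vec_T f.
Proof.
move=> fT fP; split=> //; have [p pf rp] := exists_reduced fT.
exists p; split=> //; case: fP => fP.
- exact: (@parity_bipartite R p f false).
- exact: (@parity_bipartite R p f true).
Qed.
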